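(* Let $f(z)=z+a_2z^2+a_3z^3+\cdots$ belong to the class $C$. Then $$|H_3(1)|\leq\frac{15}{24}.$$
   Context: Let $E=\{z\in\mathbb{C}:|z|<1\}$ be the open unit disk and let $A$ be the class of functions $f(z)=z+a_2z^2+a_3z^3+\cdots$ analytic in $E$. The class $C$ of convex functions consists of all $f\in A$ such that $\operatorname{Re}\,\bigl(1+zf''(z)/f'(z)\bigr)>0$ for all $z\in E$. For $f\in A$, with $a_1=1$, the Hankel determinant $H_3(1)$ is $$H_3(1)=\begin{vmatrix} a_1 & a_2 & a_3\\ a_2 & a_3 & a_4\\ a_3 & a_4 & a_5\end{vmatrix}=a_3(a_2a_4-a_3^2)-a_4(a_4-a_2a_3)+a_5(a_3-a_2^2).$$ *)

(* Defs.v *)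
From Stdlib Require Import Reals.
From Coquelicot Require Import Coquelicot.

Open Scope R_scope.
Open Scope C_scope.

(* f(z) = z + a_2 z^2 + a_3 z^3 + ... on the open unit disk; convergence of the
   power series to f on the whole disk is what makes f analytic there.  The
   sequence [a] is determined by f. *)
Definition normalized_expansion (f : C -> C) (a : nat -> C) : Prop :=
  a 0%nat = 0 /\ a 1%nat = 1 /\
  forall z : C, (Cmod z < 1)%R ->
    @is_pseries C_AbsRing C_NormedModule a z (f z).

Definition class_A (f : C -> C) : Prop :=
  exists a : nat -> C, normalized_expansion f a.

(* [f1] and [f2] are f' and f'' on the disk, as genuine complex derivatives:
   [C_derive] only takes a limit along the real direction.  The quotient f''/f'
   is only meaningful where f' does not vanish; as division is total here, this
   has to be required explicitly. *)
Definition class_convex (f : C -> C) : Prop :=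
  class_A f /\
  exists f1 f2 : C -> C, forall z : C, (Cmod z < 1)%R ->
    @is_derive C_AbsRing C_NormedModule f z (f1 z) /\
    @is_derive C_AbsRing C_NormedModule f1 z (f2 z) /\
    f1 z <> 0 /\
    (0 < Re (1 + z * f2 z / f1 z))%R.

Definition det3 (m11 m12 m13 m21 m22 m23 m31 m32 m33 : C) : C :=
  m11 * (m22 * m33 - m23 * m32)
  - m12 * (m21 * m33 - m23 * m31)
  + m13 * (m21 * m32 - m22 * m31).

Definition hankel_H31 (a : nat -> C) : C :=
  det3 (a 1%nat) (a 2%nat) (a 3%nat)
       (a 2%nat) (a 3%nat) (a 4%nat)
       (a 3%nat) (a 4%nat) (a 5%nat).

Lemma hankel_H31_expand (a : nat -> C) : a 1%nat = 1 ->
  hankel_H31 a =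
    a 3%nat * (a 2%nat * a 4%nat - a 3%nat * a 3%nat)
    - a 4%nat * (a 4%nat - a 2%nat * a 3%nat)
    + a 5%nat * (a 3%nat - a 2%nat * a 2%nat).
Proof. intros H; unfold hankel_H31, det3; rewrite H; ring. Qed.

(* Main.v *)
Require Import Defs.
From Stdlib Require Import Reals Lra Lia.
From Coquelicot Require Import Coquelicot.
Local Open Scope C_scope.

(** For [f] convex, [p z = 1 + z * f'' z / f' z] has positive real part on the
    unit disk and [p 0 = 1], so Caratheodory's inequality bounds each of its
    Taylor coefficients [c_1, c_2, ...] by 2.  Comparing coefficients in
    [p * f' = (z f')'] expresses [a_2, ..., a_5] through [c_1, ..., c_4], and
    [8640 * H_3(1)] becomes an integer polynomial in the [c_k], isobaric of
    weight 6 ([hankel_H31_caratheodory]).  The triangle inequality alone bounds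
    it by 1920, and 1920 / 8640 = 2 / 9 < 15 / 24.

    Caratheodory's inequality is the substantial step ([caratheodory_bound]).
    It rests on the mean value property: for [h] holomorphic on the disk, the
    mean of [Re h] over the circle of radius [r] is [Re (h 0)]
    ([mean_value_property]).  This holds because [r d/dr (Re h)] is
    [d/dtheta (Im h)], whose integral over a full turn vanishes, so that the
    mean does not depend on [r].

    The Taylor series of [p] is never shown to converge.  [p = N / D] is a
    quotient of two power series convergent on the disk, with [D] free of
    zeros; one step of long division writes [N = c_0 D + z N_1] with [N_1] a
    convergent power series again.  On the circle of radius [r] one has
    [z * conj z = r^2], hence
      [(N / D) * conj z ^ (n+1) = c_0 * conj z ^ (n+1) + r^2 * (N_1 / D) * conj z ^ n]
    where the first term has mean 0.  By induction the mean of
    [(N / D) * conj z ^ n] is [r^(2n) c_n] ([mean_quotient_conj_pow]), which is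
    all that the inequality needs. *)

(** * Power series on the unit disk *)

Definition expands (a : nat -> C) (g : C -> C) : Prop :=
  forall z : C, (Cmod z < 1)%R ->
    @is_pseries C_AbsRing C_NormedModule a z (g z).

Definition deriv_coef (a : nat -> C) (n : nat) : C := INR (S n) * a (S n).

Definition Cderivative (g : C -> C) (z l : C) : Prop :=
  @is_derive C_AbsRing C_NormedModule g z l.

Lemma pow_n_Cpow (z : C) (n : nat) : @pow_n C_AbsRing z n = z ^ n.
Proof.
  induction n as [|n IH]; [reflexivity|].
  change (z * @pow_n C_AbsRing z n = z * z ^ n). now rewrite IH.
Qed.

Lemma is_series_Cmod_le (u : nat -> C) (b : nat -> R) (l : C) (B : R) :
  @is_series C_AbsRing C_NormedModule u l ->
  (forall n, (Cmod (u n) <= b n)%R) -> is_series b B -> (Cmod l <= B)%R.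
Proof.
  intros Hu Hb HB.
  assert (Hn : forall n, (Cmod (@sum_n C_AbelianMonoid u n) <= sum_n b n)%R).
  { intros n.
    apply Rle_trans with (sum_n (fun k => Cmod (u k)) n);
      [exact (@norm_sum_n_m C_AbsRing C_NormedModule u 0%nat n)|].
    apply sum_n_m_le; intros k; apply Hb. }
  assert (Hl : is_lim_seq (fun n => Cmod (@sum_n C_AbelianMonoid u n)) (Cmod l)).
  { unfold is_lim_seq. simpl.
    refine (filterlim_comp _ _ _ _ (@norm C_AbsRing C_NormedModule) _ _ _ Hu _).
    apply (@filterlim_norm C_AbsRing C_NormedModule). }
  exact (is_lim_seq_le _ _ (Finite _) (Finite _) Hn Hl HB).
Qed.

Lemma is_series_C_ext (u v : nat -> C) (l : C) : (forall n, u n = v n) ->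
  @is_series C_AbsRing C_NormedModule u l -> @is_series C_AbsRing C_NormedModule v l.
Proof. intros E; apply is_series_ext; exact E. Qed.

Lemma expands_series (a : nat -> C) g z : expands a g -> (Cmod z < 1)%R ->
  @is_series C_AbsRing C_NormedModule (fun n => z ^ n * a n) (g z).
Proof.
  intros H Hz. apply (is_series_C_ext _ _ _ (fun n => f_equal (fun w => w * a n) (pow_n_Cpow z n))).
  exact (H z Hz).
Qed.

Lemma is_series_shift (u : nat -> C) (l : C) :
  @is_series C_AbsRing C_NormedModule u l ->
  @is_series C_AbsRing C_NormedModule (fun n => u (S n)) (l - u 0%nat).
Proof.
  intros H. apply (is_series_incr_1 (V := C_NormedModule)).
  replace (@plus _ _ _) with l; [exact H|].
  change (l = l - u 0%nat + u 0%nat). ring.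
Qed.

(** The terms of a convergent series are bounded, so convergence at every
    [r < 1] forces radius at least 1 for the moduli; this transfers the real
    theory of absolute convergence and of termwise derivatives. *)
Lemma CV_radius_disk (a : nat -> C) (g : C -> C) :
  expands a g -> Rbar_le 1%R (CV_radius (fun n => Cmod (a n))).
Proof.
  intros H. apply Rbar_not_lt_le; intros Hlt.
  pose proof (CV_radius_ge_0 (fun n => Cmod (a n))) as H0.
  pose proof (CV_radius_bounded (fun n => Cmod (a n))) as [Hub _].
  destruct (CV_radius (fun n => Cmod (a n))) as [rho| |]; simpl in *; try easy.
  set (r := ((rho + 1) / 2)%R) in *.
  assert (Hr : (rho < r < 1)%R) by (unfold r; lra).
  assert (Hz : (Cmod (RtoC r) < 1)%R) by (rewrite Cmod_R, Rabs_pos_eq; lra).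
  pose proof (expands_series _ _ _ H Hz) as Hs.
  destruct (@filterlim_bounded C_AbsRing C_NormedModule _ (ex_intro _ _ Hs)) as [M HM].
  change (forall n, (Cmod (@sum_n C_AbelianMonoid (fun k => (RtoC r ^ k * a k)%C) n) <= M)%R) in HM.
  assert (Hb : forall n, (Rabs (Cmod (a n) * r ^ n) <= M + M)%R).
  { intros n.
    assert (E : (Rabs (Cmod (a n) * r ^ n) = Cmod (RtoC r ^ n * a n))%R).
    { rewrite Cmod_mult, Cmod_pow, Cmod_R, (Rabs_pos_eq r) by lra.
      rewrite Rabs_pos_eq; [ring|].
      apply Rmult_le_pos; [apply Cmod_ge_0 | apply pow_le; lra]. }
    rewrite E; clear E.
    pose proof (HM n) as Hn.
    assert (HM0 : (0 <= M)%R) by (eapply Rle_trans; [apply Cmod_ge_0|exact Hn]).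
    destruct n as [|n].
    - rewrite sum_O in Hn. lra.
    - rewrite sum_Sn in Hn. pose proof (HM n) as Hn'.
      set (S := @sum_n C_AbelianMonoid _ n) in Hn, Hn'.
      change (Cmod (S + RtoC r ^ (Datatypes.S n) * a (Datatypes.S n)) <= M)%R in Hn.
      replace (RtoC r ^ (Datatypes.S n) * a (Datatypes.S n)) with
        ((S + RtoC r ^ (Datatypes.S n) * a (Datatypes.S n)) + - S) by ring.
      eapply Rle_trans; [apply Cmod_triangle|]. rewrite Cmod_opp. lra. }
  specialize (Hub r (ex_intro _ _ Hb)). simpl in Hub. lra.
Qed.

(** The sum is produced as the limit of the partial sums, chosen by [iota] to
    make it a function of [z]. *)
Lemma deriv_coef_expands (a : nat -> C) (g : C -> C) :
  expands a g -> exists g', expands (deriv_coef a) g'.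
Proof.
  intros H.
  set (psum := fun z => @sum_n C_AbelianMonoid
    (fun n => @scal C_AbsRing C_NormedModule (@pow_n C_AbsRing z n) (deriv_coef a n))).
  exists (fun z => iota (T := C_CompleteNormedModule) (is_filter_lim (filtermap (psum z) eventually))).
  intros z Hz.
  assert (Hs : ex_series (fun n => Cmod (deriv_coef a n) * Cmod z ^ n)%R).
  { apply (ex_series_ext (fun n => Rabs (PS_derive (fun n => Cmod (a n)) n * Cmod z ^ n))).
    { intros n. unfold PS_derive, deriv_coef. rewrite Cmod_mult, Cmod_R.
      rewrite !Rabs_mult, (Rabs_pos_eq (Cmod (a _))) by apply Cmod_ge_0.
      rewrite (Rabs_pos_eq (Cmod z ^ n)); [reflexivity|].
      apply pow_le, Cmod_ge_0. }
    apply CV_disk_inside. rewrite CV_radius_derive.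
    rewrite Rabs_pos_eq by apply Cmod_ge_0.
    eapply Rbar_lt_le_trans; [|apply (CV_radius_disk _ _ H)]. exact Hz. }
  destruct (@ex_series_le C_AbsRing C_CompleteNormedModule
      (fun n => @scal C_AbsRing C_NormedModule (@pow_n C_AbsRing z n) (deriv_coef a n))
      (fun n => Cmod (deriv_coef a n) * Cmod z ^ n)%R) as [l Hl]; [|exact Hs|].
  { intros n. rewrite pow_n_Cpow.
    change (Cmod (z ^ n * deriv_coef a n) <= Cmod (deriv_coef a n) * Cmod z ^ n)%R.
    rewrite Cmod_mult, Cmod_pow. lra. }
  assert (El : iota (T := C_CompleteNormedModule)
     (is_filter_lim (filtermap (psum z) eventually)) = l).
  { apply (@iota_is_filter_lim C_AbsRing C_CompleteNormedModule); [|exact Hl].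
    apply Proper_StrongProper, filtermap_proper_filter, eventually_filter. }
  rewrite El. exact Hl.
Qed.

(** Second-order Taylor remainder of [y ^ n] at [z], bounded by induction on the
    exponent through [R_(n+1) = y R_n + n z ^ (n-1) (y - z) ^ 2].  The constant
    is the coefficient of the twice differentiated series, so that the
    remainders sum. *)
Lemma pow_remainder_bound (y z : C) (s : R) (n : nat) :
  (Cmod y <= s)%R -> (Cmod z <= s)%R ->
  (Cmod (y ^ S (S n) - z ^ S (S n) - INR (S (S n)) * z ^ S n * (y - z))
     <= INR (S (S n)) * INR (S n) * s ^ n * Cmod (y - z) ^ 2)%R.
Proof.
  intros Hy Hz.
  pose proof (Cmod_ge_0 y) as Hy0. pose proof (Cmod_ge_0 z) as Hz0.
  induction n as [|n IH].
  - replace (y ^ 2 - z ^ 2 - INR 2 * z ^ 1 * (y - z)) with ((y - z) ^ 2).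
    + rewrite Cmod_pow. simpl INR. pose proof (pow2_ge_0 (Cmod (y - z))). simpl pow at 2. lra.
    + simpl INR. rewrite RtoC_plus. simpl. ring.
  - set (m := S n) in *.
    replace (y ^ S (S m) - z ^ S (S m) - INR (S (S m)) * z ^ S m * (y - z))
      with (y * (y ^ S m - z ^ S m - INR (S m) * z ^ m * (y - z))
            + INR (S m) * z ^ m * (y - z) ^ 2).
    2:{ rewrite (S_INR (S m)), RtoC_plus. rewrite !Cpow_S. ring. }
    eapply Rle_trans; [apply Cmod_triangle|].
    rewrite !Cmod_mult, !Cmod_pow, Cmod_R, (Rabs_pos_eq (INR _)) by apply pos_INR.
    set (A := Cmod (y ^ S m - _ - _)) in *.
    set (D := (Cmod (y - z) ^ 2)%R) in *.
    assert (HD : (0 <= D)%R) by apply pow2_ge_0.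
    assert (HA : (0 <= A)%R) by apply Cmod_ge_0.
    assert (H1 : (Cmod y * A <= s * (INR (S m) * INR m * s ^ n * D))%R)
      by (apply Rmult_le_compat; assumption).
    assert (H2 : (Cmod z ^ m <= s ^ m)%R) by (apply pow_incr; lra).
    assert (H3 : (INR (S m) * Cmod z ^ m * D <= INR (S m) * s ^ m * D)%R).
    { apply Rmult_le_compat_r; [exact HD|]. apply Rmult_le_compat_l; [apply pos_INR|exact H2]. }
    assert (Hq : (0 <= INR (S m) * s ^ m * D)%R).
    { apply Rmult_le_pos; [|exact HD].
      apply Rmult_le_pos; [apply pos_INR|apply pow_le; lra]. }
    assert (E : (s * (INR (S m) * INR m * s ^ n * D) = INR m * (INR (S m) * s ^ m * D))%R)
      by (unfold m; simpl pow; ring).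
    rewrite E in H1.
    replace (INR (S (S m)) * INR (S m) * s ^ m * D)%R
      with (INR (S (S m)) * (INR (S m) * s ^ m * D))%R by ring.
    rewrite !S_INR in *. lra.
Qed.

Lemma Cderivative_of_quadratic_remainder (g : C -> C) (z l : C) (d K : R) :
  (0 < d)%R ->
  (forall y, (Cmod (y - z) < d)%R ->
     (Cmod (g y - g z - (y - z) * l) <= K * Cmod (y - z) ^ 2)%R) ->
  Cderivative g z l.
Proof.
  intros Hd HK. split; [apply is_linear_scal_l|].
  intros x Hx.
  assert (E : z = x) by exact (is_filter_lim_locally_unique (V := AbsRing_NormedModule C_AbsRing) _ _ Hx).
  subst x. intros eps.
  assert (HK1 : (0 < 1 + Rabs K)%R) by (pose proof (Rabs_pos K); lra).
  assert (Hd' : (0 < Rmin d (eps / (1 + Rabs K)))%R).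
  { apply Rmin_pos; [exact Hd|]. apply Rdiv_lt_0_compat; [apply cond_pos|exact HK1]. }
  exists (mkposreal _ Hd'). intros y Hy.
  change (Cmod (y - z) < Rmin d (eps / (1 + Rabs K)))%R in Hy.
  assert (H1 : (Cmod (y - z) < d)%R) by (eapply Rlt_le_trans; [exact Hy|apply Rmin_l]).
  assert (H2 : (Cmod (y - z) < eps / (1 + Rabs K))%R)
    by (eapply Rlt_le_trans; [exact Hy|apply Rmin_r]).
  change (Cmod (g y - g z - (y - z) * l) <= eps * Cmod (y - z))%R.
  eapply Rle_trans; [exact (HK y H1)|].
  pose proof (Cmod_ge_0 (y - z)) as H0.
  replace (K * Cmod (y - z) ^ 2)%R with ((K * Cmod (y - z)) * Cmod (y - z))%R by ring.
  apply Rmult_le_compat_r; [exact H0|].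
  apply Rle_trans with ((1 + Rabs K) * Cmod (y - z))%R.
  - apply Rmult_le_compat_r; [exact H0|]. pose proof (Rle_abs K). lra.
  - apply (Rmult_lt_compat_l (1 + Rabs K)) in H2; [|exact HK1].
    replace ((1 + Rabs K) * (eps / (1 + Rabs K)))%R with (pos eps) in H2 by (field; lra). lra.
Qed.

Lemma expands_0 (a : nat -> C) g : expands a g -> g 0 = a 0%nat.
Proof.
  intros H.
  assert (H0 : (Cmod 0 < 1)%R) by (rewrite Cmod_0; lra).
  exact (filterlim_locally_unique _ _ _ (H 0 H0) (is_pseries_0 (V := C_NormedModule) a)).
Qed.

(** With [|z| < s < 1], the remainder of the whole series at a point [y] of the
    disk of radius [s] is at most [K |y - z|^2], where [K] is the sum at [s] of
    the second derivative of the series of moduli. *)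
Theorem power_series_derivative (a : nat -> C) (g g' : C -> C) (z : C) :
  expands a g -> expands (deriv_coef a) g' -> (Cmod z < 1)%R -> Cderivative g z (g' z).
Proof.
  intros H H' Hz.
  pose proof (Cmod_ge_0 z) as Hz0.
  set (s := ((1 + Cmod z) / 2)%R).
  assert (Hs : (Cmod z < s < 1)%R) by (unfold s; lra).
  set (b := PS_derive (PS_derive (fun n => Cmod (a n)))).
  assert (Hb : ex_series (fun n => b n * s ^ n)%R).
  { apply (ex_series_ext (fun n => Rabs (b n * s ^ n))).
    { intros n. apply Rabs_pos_eq. unfold b, PS_derive.
      repeat apply Rmult_le_pos; try apply pos_INR; [apply Cmod_ge_0|apply pow_le; lra]. }
    apply CV_disk_inside. unfold b. rewrite !CV_radius_derive, Rabs_pos_eq by lra.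
    eapply Rbar_lt_le_trans; [|apply (CV_radius_disk _ _ H)]. simpl; lra. }
  destruct Hb as [K HK].
  apply (Cderivative_of_quadratic_remainder _ _ _ (s - Cmod z) K); [lra|].
  intros y Hy.
  assert (Hys : (Cmod y < s)%R).
  { replace y with ((y - z) + z) by ring. eapply Rle_lt_trans; [apply Cmod_triangle|]. lra. }
  assert (Hy1 : (Cmod y < 1)%R) by lra.
  pose proof (expands_series _ _ _ H Hz) as Sz.
  pose proof (expands_series _ _ _ H Hy1) as Sy.
  pose proof (expands_series _ _ _ H' Hz) as Sd.
  assert (Su : @is_series C_AbsRing C_NormedModule
    (fun n => (y ^ S n - z ^ S n - INR (S n) * z ^ n * (y - z)) * a (S n))
    (g y - g z - (y - z) * g' z)).
  { pose proof (is_series_minus _ _ _ _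
      (is_series_minus _ _ _ _ (is_series_shift _ _ Sy) (is_series_shift _ _ Sz))
      (@is_series_scal C_AbsRing C_NormedModule (y - z) _ _ Sd)) as S1.
    apply (is_series_C_ext _ (fun n => (y ^ S n - z ^ S n - INR (S n) * z ^ n * (y - z)) * a (S n))) in S1.
    - replace (g y - g z - (y - z) * g' z) with
        ((g y - y ^ 0 * a 0%nat) - (g z - z ^ 0 * a 0%nat) - (y - z) * g' z) by (simpl; ring).
      exact S1.
    - intros n. unfold deriv_coef.
      change ((y ^ S n * a (S n) - z ^ S n * a (S n)) - (y - z) * (z ^ n * (INR (S n) * a (S n)))
        = (y ^ S n - z ^ S n - INR (S n) * z ^ n * (y - z)) * a (S n)). ring. }
  (* The remainder of degree 1 is zero; dropping it leaves the terms bounded above. *)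
  apply is_series_shift in Su.
  replace (_ - _ * a 1%nat) with (g y - g z - (y - z) * g' z) in Su by (simpl; ring).
  apply (is_series_Cmod_le _ (fun n => b n * s ^ n * Cmod (y - z) ^ 2)%R _ _ Su).
  - intros n. rewrite Cmod_mult.
    pose proof (pow_remainder_bound y z s n (Rlt_le _ _ Hys) (Rlt_le _ _ (proj1 Hs))) as Hr.
    apply (Rmult_le_compat_r (Cmod (a (S (S n))))) in Hr; [|apply Cmod_ge_0].
    eapply Rle_trans; [exact Hr|]. unfold b, PS_derive. right; ring.
  - apply (is_series_ext (fun n => Cmod (y - z) ^ 2 * (b n * s ^ n))%R).
    { intros n; apply Rmult_comm. }
    rewrite (Rmult_comm K). exact (is_series_scal (K := R_AbsRing) (Cmod (y - z) ^ 2)%R _ _ HK).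
Qed.

(** * Holomorphic functions *)

Definition Ccontinuous (h : C -> C) (z : C) : Prop :=
  @continuous (AbsRing_UniformSpace C_AbsRing) (AbsRing_UniformSpace C_AbsRing) h z.

(** A complex derivative that is moreover continuous: differentiating the
    circular means under the integral sign needs that continuity. *)
Definition holomorphic (h : C -> C) : Prop :=
  exists h' : C -> C, forall z, (Cmod z < 1)%R -> Cderivative h z (h' z) /\ Ccontinuous h' z.

(** [C] carries two normed module structures over itself, which differ by the
    uniform structure only (squares or round balls); the product rule is a
    statement about the second. *)
Lemma Cderivative_AbsRing h z l :
  Cderivative h z l <->
  @is_derive C_AbsRing (AbsRing_NormedModule C_AbsRing) h z l.
Proof.
  split; intros [_ H]; (split; [apply is_linear_scal_l | exact H]).
Qed.

Lemma Cderivative_continuous h z l : Cderivative h z l -> Ccontinuous h z.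
Proof.
  intros H. apply (ex_derive_continuous (V := AbsRing_NormedModule C_AbsRing)).
  exists l. now apply Cderivative_AbsRing.
Qed.

Lemma Cderivative_mult h g z dh dg :
  Cderivative h z dh -> Cderivative g z dg ->
  Cderivative (fun w => h w * g w) z (dh * g z + h z * dg).
Proof.
  rewrite !Cderivative_AbsRing. intros Hh Hg.
  exact (is_derive_mult h g z dh dg Hh Hg Cmult_comm).
Qed.

Lemma Ccontinuous_mult h g z : Ccontinuous h z -> Ccontinuous g z ->
  Ccontinuous (fun w => h w * g w) z.
Proof. exact (continuous_mult (U := AbsRing_UniformSpace C_AbsRing) (K := C_AbsRing) h g z). Qed.

Lemma Ccontinuous_plus h g z : Ccontinuous h z -> Ccontinuous g z ->
  Ccontinuous (fun w => h w + g w) z.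
Proof. exact (continuous_plus (U := AbsRing_UniformSpace C_AbsRing)
    (V := AbsRing_NormedModule C_AbsRing) h g z). Qed.

Lemma Ccontinuous_const c z : Ccontinuous (fun _ => c) z.
Proof. exact (continuous_const (U := AbsRing_UniformSpace C_AbsRing) (V := AbsRing_UniformSpace C_AbsRing) c z). Qed.

Lemma Cderivative_inv (w : C) : w <> 0 -> Cderivative Cinv w (- / (w * w)).
Proof.
  intros Hw. pose proof (proj1 (Cmod_gt_0 w) Hw) as H0.
  apply (Cderivative_of_quadratic_remainder _ _ _ (Cmod w / 2) (2 / Cmod w ^ 3)); [lra|].
  intros y Hy.
  assert (Hyw : (Cmod w / 2 < Cmod y)%R).
  { assert (Cmod w <= Cmod y + Cmod (y - w))%R; [|lra].
    replace w with (y + - (y - w)) at 1 by ring.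
    eapply Rle_trans; [apply Cmod_triangle|]. rewrite Cmod_opp. lra. }
  assert (Hy0 : y <> 0) by (apply Cmod_gt_0; lra).
  replace (/ y - / w - (y - w) * - / (w * w)) with ((y - w) ^ 2 * / (y * (w * w)))
    by (simpl; field; auto).
  rewrite Cmod_mult, Cmod_pow, Cmod_inv, !Cmod_mult
    by (repeat apply Cmult_neq_0; assumption).
  rewrite Rmult_comm. apply Rmult_le_compat_r; [apply pow2_ge_0|].
  replace (2 / Cmod w ^ 3)%R with (/ (Cmod w / 2 * (Cmod w * Cmod w)))%R by (field; lra).
  apply Rinv_le_contravar.
  - repeat apply Rmult_lt_0_compat; lra.
  - apply Rmult_le_compat_r; [apply Rmult_le_pos|]; lra.
Qed.

Lemma holomorphic_const c : holomorphic (fun _ => c).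
Proof.
  exists (fun _ => 0). intros z _. split; [|apply Ccontinuous_const].
  exact (is_derive_const (V := C_NormedModule) c z).
Qed.

Lemma holomorphic_id : holomorphic (fun z => z).
Proof.
  exists (fun _ => 1). intros z _. split; [|apply Ccontinuous_const].
  apply Cderivative_AbsRing. exact (is_derive_id (K := C_AbsRing) z).
Qed.

Lemma holomorphic_mult h g : holomorphic h -> holomorphic g -> holomorphic (fun z => h z * g z).
Proof.
  intros [h' Hh] [g' Hg]. exists (fun z => h' z * g z + h z * g' z).
  intros z Hz. destruct (Hh z Hz) as [Dh Ch], (Hg z Hz) as [Dg Cg]. split.
  - now apply Cderivative_mult.
  - apply Ccontinuous_plus; apply Ccontinuous_mult; trivial;
      eapply Cderivative_continuous; eassumption.
Qed.

Lemma holomorphic_inv h : holomorphic h -> (forall z, (Cmod z < 1)%R -> h z <> 0) ->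
  holomorphic (fun z => / h z).
Proof.
  intros [h' Hh] H0. exists (fun z => h' z * (- (1) * (/ h z * / h z))).
  intros z Hz. destruct (Hh z Hz) as [Dh Ch].
  assert (Dq : Cderivative (fun w => / h w) z (h' z * (- (1) * (/ h z * / h z)))).
  { replace (- (1) * (/ h z * / h z)) with (- / (h z * h z)) by (field; auto).
    exact (is_derive_comp (V := C_NormedModule) Cinv h z _ _ (Cderivative_inv _ (H0 z Hz))
      (proj1 (Cderivative_AbsRing _ _ _) Dh)). }
  pose proof (Cderivative_continuous _ _ _ Dq) as Cq.
  split; [exact Dq|].
  apply Ccontinuous_mult; [exact Ch|].
  apply Ccontinuous_mult; [apply Ccontinuous_const|].
  now apply Ccontinuous_mult.
Qed.

Lemma holomorphic_pow n : holomorphic (fun z => z ^ n).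
Proof.
  induction n as [|n IH]; [exact (holomorphic_const 1)|].
  exact (holomorphic_mult _ _ holomorphic_id IH).
Qed.

Lemma holomorphic_power_series a g : expands a g -> holomorphic g.
Proof.
  intros H.
  destruct (deriv_coef_expands _ _ H) as [g1 H1].
  destruct (deriv_coef_expands _ _ H1) as [g2 H2].
  exists g1. intros z Hz. split.
  - exact (power_series_derivative _ _ _ _ H H1 Hz).
  - exact (Cderivative_continuous _ _ _ (power_series_derivative _ _ _ _ H1 H2 Hz)).
Qed.

(** One half of the Cauchy-Riemann equations, in the form suited to the real
    chain rule in two variables. *)
Lemma Cderivative_Re_differentiable h x y l :
  Cderivative h (x, y) l ->
  differentiable_pt_lim (fun u v => Re (h (u, v))) x y (Re l) (- Im l).
Proof.
  intros [_ H] eps.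
  (* The factor compares the modulus with the maximum norm on pairs. *)
  assert (He : (0 < eps / sqrt 2)%R).
  { apply Rdiv_lt_0_compat; [apply cond_pos|apply sqrt_lt_R0; lra]. }
  specialize (H (x, y) (fun P HP => HP) (mkposreal _ He)).
  apply (proj2 (locally_C (x, y) _)) in H.
  destruct H as [d Hd]. exists d. intros u v Hu Hv.
  specialize (Hd (u, v) (conj Hu Hv)).
  change (Cmod (h (u, v) - h (x, y) - ((u, v) - (x, y)) * l)
    <= eps / sqrt 2 * Cmod ((u, v) - (x, y)))%R in Hd.
  pose proof (Cmod_2Rmax ((u, v) - (x, y))) as Hm.
  change (fst ((u, v) - (x, y))) with (u - x)%R in Hm.
  change (snd ((u, v) - (x, y))) with (v - y)%R in Hm.
  replace (Re (h (u, v)) - Re (h (x, y)) - (Re l * (u - x) + - Im l * (v - y)))%R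
    with (Re (h (u, v) - h (x, y) - ((u, v) - (x, y)) * l))
    by (destruct (h (u, v)), (h (x, y)), l; unfold Re, Im; simpl; ring).
  eapply Rle_trans; [apply re_le_Cmod|]. eapply Rle_trans; [exact Hd|].
  apply (Rmult_le_compat_l (eps / sqrt 2)) in Hm; [|lra].
  eapply Rle_trans; [exact Hm|]. right. field.
  apply Rgt_not_eq, sqrt_lt_R0; lra.
Qed.

(** The factor [c] gives access to imaginary parts as well, as [Im w] is
    [Re (- i w)]. *)
Lemma Re_scaled_derivative (h : C -> C) (c l : C) (X Y : R -> R) (t dX dY : R) :
  Cderivative h (X t, Y t) l -> is_derive X t dX -> is_derive Y t dY ->
  is_derive (fun s => Re (c * h (X s, Y s))) t (Re (c * (l * (dX, dY)))).
Proof.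
  intros H HX HY.
  assert (Hc : Cderivative (fun w => c * h w) (X t, Y t) (c * l)).
  { replace (c * l) with (0 * h (X t, Y t) + c * l) by ring.
    apply (Cderivative_mult (fun _ => c)); [|exact H].
    exact (is_derive_const (V := C_NormedModule) c _). }
  apply is_derive_Reals in HX. apply is_derive_Reals in HY.
  apply is_derive_Reals.
  replace (Re _) with (Re (c * l) * dX + - Im (c * l) * dY)%R
    by (destruct c, l; unfold Re, Im; simpl; ring).
  exact (derivable_pt_lim_comp_2d (fun u v => Re (c * h (u, v))) X Y t _ _ _ _
    (Cderivative_Re_differentiable _ _ _ _ Hc) HX HY).
Qed.

(** * The mean value property *)

Definition circle_pt (r t : R) : C := (r * cos t, r * sin t)%R.

Lemma circle_pt_polar r t : circle_pt r t = r * (cos t, sin t).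
Proof. unfold circle_pt, Cmult, RtoC; simpl. f_equal; ring. Qed.

Lemma Cmod_circle_pt r t : Cmod (circle_pt r t) = Rabs r.
Proof.
  rewrite circle_pt_polar, Cmod_mult, Cmod_R. unfold Cmod; simpl.
  replace (cos t * (cos t * 1) + sin t * (sin t * 1))%R with 1%R.
  - rewrite sqrt_1; ring.
  - pose proof (sin2_cos2 t) as H; unfold Rsqr in H; lra.
Qed.

Lemma Cderivative_radial h r t l : Cderivative h (circle_pt r t) l ->
  is_derive (fun s => Re (h (circle_pt s t))) r (Re (l * (cos t, sin t))).
Proof.
  intros H.
  apply (is_derive_ext (fun s => Re (1 * h ((s * cos t)%R, (s * sin t)%R)))).
  { intros s. now rewrite Cmult_1_l. }
  rewrite <- (Cmult_1_l (l * _)).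
  apply (Re_scaled_derivative h 1 l (fun s => s * cos t)%R (fun s => s * sin t)%R r); [exact H| |];
    auto_derive; trivial; ring.
Qed.

Lemma Cderivative_angular h c r t l : Cderivative h (circle_pt r t) l ->
  is_derive (fun s => Re (c * h (circle_pt r s))) t
    (Re (c * (l * (- (r * sin t), r * cos t)%R))).
Proof.
  intros H.
  apply (Re_scaled_derivative h c l (fun s => r * cos s)%R (fun s => r * sin s)%R t); [exact H| |];
    auto_derive; trivial; ring.
Qed.

Lemma polar_continuity_2d (k : C -> C) r t : Ccontinuous k (circle_pt r t) ->
  continuity_2d_pt (fun u v => Re (k (circle_pt u v))) r t /\
  continuity_2d_pt (fun u v => Im (k (circle_pt u v))) r t.
Proof.
  intros Hk.
  assert (Hc : continuity_2d_pt (fun u v => u * cos v)%R r t).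
  { apply continuity_2d_pt_mult; [apply continuity_2d_pt_id1|].
    apply (continuity_1d_2d_pt_comp cos (fun _ v => v)); [apply continuity_cos|].
    apply continuity_2d_pt_id2. }
  assert (Hs : continuity_2d_pt (fun u v => u * sin v)%R r t).
  { apply continuity_2d_pt_mult; [apply continuity_2d_pt_id1|].
    apply (continuity_1d_2d_pt_comp sin (fun _ v => v)); [apply continuity_sin|].
    apply continuity_2d_pt_id2. }
  assert (HK : forall eps : posreal, locally_2d (fun u v =>
     (Cmod (k (circle_pt u v) - k (circle_pt r t)) < eps)%R) r t).
  { intros eps.
    destruct (proj2 (locally_C (circle_pt r t) _) (Hk _ (@locally_ball (AbsRing_UniformSpace C_AbsRing) (k (circle_pt r t)) eps)))
      as [d Hd].
    generalize (locally_2d_and _ _ _ _ (Hc d) (Hs d)).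
    apply locally_2d_impl, locally_2d_forall. intros u v [H1 H2].
    apply (Hd (circle_pt u v)). split; assumption. }
  split; intros eps; generalize (HK eps); apply locally_2d_impl, locally_2d_forall;
    intros u v Huv; (eapply Rle_lt_trans; [|exact Huv]).
  - exact (re_le_Cmod (k (circle_pt u v) - k (circle_pt r t))).
  - eapply Rle_trans; [|apply Rmax_Cmod]. apply Rmax_r.
Qed.

Lemma radial_derivative_continuity (k : C -> C) r t : Ccontinuous k (circle_pt r t) ->
  continuity_2d_pt (fun u v => Re (k (circle_pt u v) * (cos v, sin v))) r t.
Proof.
  intros Hk. destruct (polar_continuity_2d _ _ _ Hk) as [H1 H2].
  apply (continuity_2d_pt_ext (fun u v =>
    Re (k (circle_pt u v)) * cos v - Im (k (circle_pt u v)) * sin v)%R).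
  { intros u v. unfold Re, Im; simpl; ring. }
  apply continuity_2d_pt_minus; apply continuity_2d_pt_mult; trivial.
  - apply (continuity_1d_2d_pt_comp cos (fun _ v => v)); [apply continuity_cos|].
    apply continuity_2d_pt_id2.
  - apply (continuity_1d_2d_pt_comp sin (fun _ v => v)); [apply continuity_sin|].
    apply continuity_2d_pt_id2.
Qed.

(** The mean [I] satisfies [s I'(s) = 0] for [0 < s < 1]: the radial derivative of
    [Re h] is [1 / s] times the angular derivative of [Im h], which integrates
    to 0 over a period.  Continuity of [I] at 0 then gives its value. *)
Theorem mean_value_property h r : holomorphic h -> (0 <= r < 1)%R ->
  is_RInt (fun t => Re (h (circle_pt r t))) 0 (2 * PI) (2 * PI * Re (h 0))%R.
Proof.
  intros [h' Hh] Hr.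
  assert (Hd : forall s t, (Rabs s < 1)%R ->
     Cderivative h (circle_pt s t) (h' (circle_pt s t)) /\ Ccontinuous h' (circle_pt s t)).
  { intros s t Hs. apply Hh. now rewrite Cmod_circle_pt. }
  assert (Hint : forall s, (Rabs s < 1)%R -> ex_RInt (fun t => Re (h (circle_pt s t))) 0 (2 * PI)).
  { intros s Hs. apply (ex_RInt_continuous (V := R_CompleteNormedModule)). intros t _.
    apply (continuous_ext (fun t => Re (1 * h (circle_pt s t)))).
    { intros v. now rewrite Cmult_1_l. }
    apply (ex_derive_continuous (V := R_NormedModule)).
    eexists. apply Cderivative_angular. apply Hd, Hs. }
  set (D := fun s t => Re (h' (circle_pt s t) * (cos t, sin t))).
  assert (HD : forall s t, (Rabs s < 1)%R ->
    is_derive (fun u => Re (h (circle_pt u t))) s (D s t)).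
  { intros s t Hs. apply Cderivative_radial. apply Hd, Hs. }
  assert (HDc : forall s t, (Rabs s < 1)%R -> continuity_2d_pt D s t).
  { intros s t Hs. apply radial_derivative_continuity. apply Hd, Hs. }
  assert (Hopen : forall s, (Rabs s < 1)%R -> locally s (fun u => Rabs u < 1)%R).
  { intros s Hs. apply (open_comp Rabs (fun u => u < 1)%R); [|apply open_lt|exact Hs].
    intros u _. apply continuous_Rabs. }
  set (I := fun s => RInt (fun t => Re (h (circle_pt s t))) 0 (2 * PI)).
  assert (HI : forall s, (Rabs s < 1)%R -> is_derive I s (RInt (D s) 0 (2 * PI))).
  { intros s Hs.
    replace (RInt (D s) 0 (2 * PI))
      with (RInt (fun t => Derive (fun u => Re (h (circle_pt u t))) s) 0 (2 * PI)).
    2:{ apply RInt_ext. intros t _. apply is_derive_unique, HD, Hs. }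
    apply (is_derive_RInt_param (fun s t => Re (h (circle_pt s t)))).
    - generalize (Hopen s Hs); apply filter_imp. intros u Hu t _.
      eexists; apply HD, Hu.
    - intros t _. apply (continuity_2d_pt_ext_loc D); [|apply HDc, Hs].
      destruct (Hopen s Hs) as [d Hdd]. exists d. intros u v Hu _.
      symmetry. apply is_derive_unique, HD, Hdd, Hu.
    - generalize (Hopen s Hs); apply filter_imp. exact Hint. }
  assert (H0 : forall s, (0 < s < 1)%R -> RInt (D s) 0 (2 * PI) = 0%R).
  { intros s Hs. assert (Hs' : (Rabs s < 1)%R) by (rewrite Rabs_pos_eq; lra).
    (* [A] is [Im h / s], since [(0, - / s)] is [- i / s]. *)
    set (A := fun t => Re ((0, - / s)%R * h (circle_pt s t))).
    assert (HA : is_RInt (D s) 0 (2 * PI) (minus (A (2 * PI)%R) (A 0%R))).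
    { apply (is_RInt_derive A).
      - intros t _. 
        replace (D s t) with (Re ((0, - / s)%R * (h' (circle_pt s t) * (- (s * sin t), s * cos t)%R))).
        + apply Cderivative_angular, Hd, Hs'.
        + unfold D. destruct (h' (circle_pt s t)). unfold Re; simpl. field. lra.
      - intros t _ P [e He]. destruct (HDc s t Hs' e) as [d Hd'].
        exists d. intros v Hv. apply He, Hd'; [|exact Hv].
        rewrite Rminus_diag, Rabs_R0; apply cond_pos. }
    apply (is_RInt_unique (V := R_CompleteNormedModule)) in HA. rewrite HA.
    change (A (2 * PI) - A 0 = 0)%R.
    unfold A, circle_pt. rewrite cos_2PI, sin_2PI, cos_0, sin_0. apply Rminus_diag. }
  assert (E : I r = I 0%R).
  { destruct (MVT_gen I 0 r (fun _ => 0%R)) as [c [_ Hc]].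
    - intros s Hs. rewrite Rmin_left, Rmax_right in Hs by lra.
      rewrite <- (H0 s) by lra. apply HI. rewrite Rabs_pos_eq; lra.
    - intros s Hs. rewrite Rmin_left, Rmax_right in Hs by lra.
      apply derivable_continuous_pt. eexists. apply is_derive_Reals, HI.
      rewrite Rabs_pos_eq; lra.
    - lra. }
  assert (E0 : I 0%R = (2 * PI * Re (h 0))%R).
  { unfold I. rewrite (RInt_ext _ (fun _ => Re (h 0))).
    - rewrite RInt_const. unfold scal; simpl; unfold mult; simpl. ring.
    - intros t _. unfold circle_pt. now rewrite !Rmult_0_l. }
  rewrite <- E0, <- E. apply (RInt_correct (V := R_CompleteNormedModule)), Hint.
  rewrite Rabs_pos_eq; lra.
Qed.

(** * Quotients of power series and Caratheodory's inequality *)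

(** Coefficients of the formal power series [nu / d], by long division: each
    step subtracts a multiple of [d] and divides by the variable. *)
Fixpoint quotient_coef (d nu : nat -> C) (n : nat) : C :=
  match n with
  | O => nu 0%nat / d 0%nat
  | S m => quotient_coef d (fun k => nu (S k) - nu 0%nat / d 0%nat * d (S k)) m
  end.

(** One step of long division keeps the remainder convergent on the disk, since
    dividing by [z] a series without constant term only shifts it. *)
Lemma division_step (nu d : nat -> C) (N D : C -> C) :
  expands nu N -> expands d D -> d 0%nat <> 0 ->
  exists N1, expands (fun k => nu (S k) - nu 0%nat / d 0%nat * d (S k)) N1 /\
    forall z, (Cmod z < 1)%R -> N z = nu 0%nat / d 0%nat * D z + z * N1 z.
Proof.
  intros HN HD H0. set (c := nu 0%nat / d 0%nat).
  set (nu1 := fun k => nu (S k) - c * d (S k)).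
  (* The value at 0 fills the removable singularity. *)
  set (N1 := fun z => if Ceq_dec z 0 then nu1 0%nat else (N z - c * D z) / z).
  assert (EN : forall z, (Cmod z < 1)%R -> N z = c * D z + z * N1 z).
  { intros z Hz. unfold N1. destruct (Ceq_dec z 0) as [->|Hz0]; [|field; exact Hz0].
    rewrite (expands_0 _ _ HN), (expands_0 _ _ HD). unfold c. field. exact H0. }
  exists N1. split; [|exact EN].
  intros z Hz. unfold N1. destruct (Ceq_dec z 0) as [->|Hz0].
  { exact (is_pseries_0 (V := C_NormedModule) nu1). }
  pose proof (@is_series_scal C_AbsRing C_NormedModule (/ z) _ _
    (is_series_minus _ _ _ _
      (is_series_shift _ _ (expands_series _ _ _ HN Hz))
      (@is_series_scal C_AbsRing C_NormedModule c _ _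
         (is_series_shift _ _ (expands_series _ _ _ HD Hz))))) as S1.
  replace ((N z - c * D z) / z) with
    (/ z * ((N z - z ^ 0 * nu 0%nat) - c * (D z - z ^ 0 * d 0%nat)))
    by (unfold c; simpl; field; auto).
  refine (is_series_C_ext _ _ _ _ S1). intros n.
  change (/ z * (z ^ S n * nu (S n) - c * (z ^ S n * d (S n)))
    = @pow_n C_AbsRing z n * (nu (S n) - c * d (S n))).
  rewrite (pow_n_Cpow z n), Cpow_S. field. exact Hz0.
Qed.

Lemma Re_conj_pow (c w : C) n : Re (c * Cconj w ^ n) = Re (Cconj c * w ^ n).
Proof.
  replace (Cconj c * w ^ n) with (Cconj (c * Cconj w ^ n)); [reflexivity|].
  now rewrite Cmult_conj, Cpow_conj, Cconj_conj.
Qed.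

Lemma circle_pt_mult_conj r t : circle_pt r t * Cconj (circle_pt r t) = RtoC (r ^ 2).
Proof.
  rewrite <- Cmod2_conj, Cmod_circle_pt. f_equal. apply pow2_abs.
Qed.

Lemma denominator_coef_neq_0 (d : nat -> C) (D : C -> C) :
  expands d D -> (forall z, (Cmod z < 1)%R -> D z <> 0) ->
  d 0%nat <> 0.
Proof.
  intros HD D_neq_0.
  rewrite <- (expands_0 _ _ HD). apply D_neq_0. rewrite Cmod_0; lra.
Qed.

Lemma holomorphic_quotient (nu d : nat -> C) (N D : C -> C) :
  expands d D -> (forall z, (Cmod z < 1)%R -> D z <> 0) ->
  expands nu N -> holomorphic (fun z => N z / D z).
Proof.
  intros HD D_neq_0 HN. apply holomorphic_mult.
  - exact (holomorphic_power_series _ _ HN).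
  - apply holomorphic_inv; [exact (holomorphic_power_series _ _ HD)|exact D_neq_0].
Qed.

(** The [n]-th Fourier coefficient of [N / D] on a circle is the [n]-th
    coefficient of the formal quotient, although that series is not known to
    converge.  The factor [mu] allows any direction in the plane. *)
Lemma mean_quotient_conj_pow (d : nat -> C) (D : C -> C) :
  expands d D -> (forall z, (Cmod z < 1)%R -> D z <> 0) ->
  forall n nu N mu r, expands nu N -> (0 <= r < 1)%R ->
  is_RInt (fun t => Re (mu * (N (circle_pt r t) / D (circle_pt r t)) * Cconj (circle_pt r t) ^ n))
    0 (2 * PI) (2 * PI * Re (mu * RtoC (r ^ (2 * n)) * quotient_coef d nu n))%R.
Proof.
  intros HD D_neq_0.
  induction n as [|n IH]; intros nu N mu r HN Hr.
  - pose proof (mean_value_property (fun z => mu * (N z / D z)) r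
      (holomorphic_mult _ _ (holomorphic_const mu) (holomorphic_quotient _ _ _ _ HD D_neq_0 HN)) Hr) as M.
    simpl quotient_coef. rewrite <- (expands_0 _ _ HN), <- (expands_0 _ _ HD).
    replace (mu * RtoC (r ^ (2 * 0)) * (N 0 / D 0)) with (mu * (N 0 / D 0)) by (simpl; ring).
    refine (is_RInt_ext _ _ _ _ _ _ M). intros t _.
    cbn [Cpow]. now rewrite Cmult_1_r.
  - destruct (division_step _ _ _ _ HN HD (denominator_coef_neq_0 _ _ HD D_neq_0)) as [N1 [HN1 EN]].
    (* [c * conj z ^ (n+1)] is the conjugate of a holomorphic function vanishing at 0. *)
    set (c := nu 0%nat / d 0%nat) in *.
    pose proof (mean_value_property (fun z => Cconj (mu * c) * z ^ S n) r
      (holomorphic_mult _ _ (holomorphic_const _) (holomorphic_pow (S n))) Hr) as M.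
    pose proof (IH _ _ (mu * RtoC (r ^ 2)) r HN1 Hr) as M1.
    pose proof (is_RInt_plus _ _ _ _ _ _ M M1) as M2.
    cbn [quotient_coef]. fold c.
    replace (2 * PI * Re (mu * RtoC (r ^ (2 * S n)) * _))%R with
      (plus (2 * PI * Re (Cconj (mu * c) * 0 ^ S n))%R
       (2 * PI * Re (mu * RtoC (r ^ 2) * RtoC (r ^ (2 * n)) * 
          quotient_coef d (fun k => (nu (S k) - c * d (S k))%C) n))%R).
    2:{ replace (2 * S n)%nat with (2 + 2 * n)%nat by lia.
        rewrite pow_add, RtoC_mult, Cpow_S, Cmult_0_l, Cmult_0_r, !Cmult_assoc.
        change (Re 0) with 0%R. unfold plus; simpl. ring. }
    refine (is_RInt_ext _ _ _ _ _ _ M2). intros t _.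
    set (w := circle_pt r t).
    assert (Hw : (Cmod w < 1)%R) by (unfold w; rewrite Cmod_circle_pt, Rabs_pos_eq; lra).
    rewrite <- Re_conj_pow.
    change (plus (Re ?a) (Re ?b)) with (Re (a + b)). f_equal.
    rewrite (EN w Hw), <- (circle_pt_mult_conj r t). fold w.
    rewrite Cpow_S. field. exact (D_neq_0 w Hw).
Qed.

(** With [p = N / D] and [m = n + 1], the mean over [|z| = r] of the nonnegative
    function [Re p * (1 + Re (mu * conj z ^ m))], where [|mu| r^m = 1], is
    [Re c_0 + Re (mu r^(2m) c_m) / 2].  Choosing the argument of [mu] opposite
    to that of [c_m] gives [r^m |c_m| <= 2 Re c_0]; then [r] tends to 1. *)
Theorem caratheodory_bound (nu d : nat -> C) (N D : C -> C) (n : nat) :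
  expands d D -> (forall z, (Cmod z < 1)%R -> D z <> 0) ->
    expands nu N ->
  (forall z, (Cmod z < 1)%R -> (0 <= Re (N z / D z))%R) ->
  (Cmod (quotient_coef d nu (S n)) <= 2 * Re (nu 0%nat / d 0%nat))%R.
Proof.
  intros HD D_neq_0 HN Hpos. set (m := S n). set (c := quotient_coef d nu m).
  destruct (Ceq_dec c 0) as [Hc|Hc].
  { rewrite Hc, Cmod_0. rewrite <- (expands_0 _ _ HN), <- (expands_0 _ _ HD).
    assert (0 <= Re (N 0 / D 0))%R by (apply Hpos; rewrite Cmod_0; lra). lra. }
  pose proof (proj1 (Cmod_gt_0 c) Hc) as Hc0.
  assert (Hr : forall r, (0 < r < 1)%R -> (r ^ m * Cmod c <= 2 * Re (nu 0%nat / d 0%nat))%R).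
  { intros r Hr.
    assert (Hr' : (0 <= r < 1)%R) by lra.
    assert (Hrm : (0 < r ^ m)%R) by (apply pow_lt; lra).
    set (mu := - Cconj c / RtoC (Cmod c * r ^ m)).
    assert (HX : RtoC (Cmod c * r ^ m) <> 0).
    { intros E. apply RtoC_inj in E. apply Rmult_integral in E. lra. }
    assert (Hmu : Cmod mu = (/ r ^ m)%R).
    { unfold mu. rewrite Cmod_div, Cmod_opp, Cmod_conj, Cmod_R by exact HX.
      rewrite Rabs_pos_eq by (apply Rmult_le_pos; lra). field. lra. }
    pose proof (mean_quotient_conj_pow _ _ HD D_neq_0 0 nu N 1 r HN Hr') as M0.
    pose proof (mean_quotient_conj_pow _ _ HD D_neq_0 m nu N mu r HN Hr') as M1.
    (* [Re p * Re v] is half of [Re (v p) + Re (conj v * p)], and the second product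
       is holomorphic for [v = mu * conj z ^ m], with value 0 at 0. *)
    pose proof (mean_value_property (fun z => (Cconj mu * z ^ m) * (N z / D z)) r
      (holomorphic_mult _ _ (holomorphic_mult _ _ (holomorphic_const _) (holomorphic_pow m))
         (holomorphic_quotient _ _ _ _ HD D_neq_0 HN)) Hr') as M2.
    pose proof (is_RInt_plus _ _ _ _ _ _ M0
      (is_RInt_scal _ _ _ (1 / 2)%R _ (is_RInt_plus _ _ _ _ _ _ M1 M2))) as M.
    assert (Hge : (0 <= 2 * PI * Re (1 * RtoC (r ^ (2 * 0)) * quotient_coef d nu 0)
      + 1 / 2 * (2 * PI * Re (mu * RtoC (r ^ (2 * m)) * c)
         + 2 * PI * Re (Cconj mu * 0 ^ m * (N 0 / D 0))))%R).
    { refine (is_RInt_ge_0 _ _ _ _ _ M _); [pose proof PI_RGT_0; lra|].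
      intros t _. set (w := circle_pt r t).
      assert (Hw : Cmod w = r) by (unfold w; rewrite Cmod_circle_pt, Rabs_pos_eq; lra).
      set (p := N w / D w). set (v := mu * Cconj w ^ m).
      assert (Ev : Cconj mu * w ^ m = Cconj v).
      { unfold v. now rewrite Cmult_conj, Cpow_conj, Cconj_conj. }
      rewrite Ev.
      assert (Hv : (Cmod v = 1)%R).
      { unfold v. rewrite Cmod_mult, Cmod_pow, Cmod_conj, Hmu, Hw. field. lra. }
      assert (Hp : (0 <= Re p)%R) by (apply Hpos; lra).
      assert (Hv' : (- 1 <= Re v)%R).
      { pose proof (re_le_Cmod v) as Hre. rewrite Hv in Hre. apply Rabs_le_between in Hre. lra. }
      replace (mu * p * Cconj w ^ m) with (v * p) by (unfold v; ring).
      match goal with |- (0 <= ?x)%R => replace x with (Re p * (1 + Re v))%R end.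
      { apply Rmult_le_pos; lra. }
      change (Re p * (1 + Re v) = Re (1 * p * Cconj w ^ 0) + 1 / 2 * (Re (v * p) + Re (Cconj v * p)))%R.
      clearbody p v. destruct p, v. unfold Re; simpl. field. }
    assert (Ec : mu * RtoC (r ^ (2 * m)) * c = RtoC (- (r ^ m * Cmod c))).
    { assert (Ecc : c * Cconj c = RtoC (Cmod c ^ 2)) by (symmetry; apply Cmod2_conj).
      unfold mu. replace (2 * m)%nat with (m + m)%nat by lia. rewrite pow_add.
      replace (- Cconj c / (Cmod c * r ^ m)%R * (r ^ m * r ^ m)%R * c)
        with (- (c * Cconj c) / (Cmod c * r ^ m)%R * (r ^ m * r ^ m)%R) by (field; exact HX).
      rewrite Ecc, <- RtoC_opp, <- RtoC_div, <- RtoC_mult.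
      - f_equal. field. lra.
      - intros E. apply HX. now rewrite E. }
    rewrite Ec in Hge.
    assert (E0 : Cconj mu * 0 ^ m * (N 0 / D 0) = 0) by (unfold m; rewrite Cpow_S; ring).
    rewrite E0 in Hge.
    replace (1 * RtoC (r ^ (2 * 0)) * quotient_coef d nu 0) with (nu 0%nat / d 0%nat) in Hge
      by (simpl; ring).
    change (Re (RtoC ?x)) with x in Hge. 
    pose proof PI_RGT_0 as HPI.
    apply (Rmult_le_reg_l (PI)); [exact HPI|]. lra. }
  apply Rnot_lt_le; intros Hlt.
  (* Passage to the limit: [r ^ m |c|] comes closer to [|c|] than the gap [|c| - B]. *)
  set (B := (2 * Re (nu 0%nat / d 0%nat))%R) in *.
  assert (Hcont : continuity_pt (fun r => r ^ m * Cmod c)%R 1) by (apply continuity_pt_mult;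
    [apply derivable_continuous_pt, derivable_pt_pow | apply continuity_pt_const; intros ? ?; reflexivity]).
  assert (Hgap : (0 < Cmod c - B)%R) by lra.
  destruct (Hcont _ Hgap) as [e [He Hd]].
  set (r := Rmax (1 / 2) (1 - e / 2)).
  assert (Hr1 : (0 < r < 1)%R).
  { unfold r; split; [eapply Rlt_le_trans; [|apply Rmax_l]; lra|].
    apply Rmax_lub_lt; lra. }
  assert (Hr2 : (1 - e / 2 <= r)%R) by apply Rmax_r.
  specialize (Hr r Hr1).
  assert (Hdist : (Rabs (r ^ m * Cmod c - 1 ^ m * Cmod c) < Cmod c - B)%R).
  { apply Hd. split; [split; [exact Logic.I|lra]|].
    simpl. unfold R_dist. rewrite Rabs_left; lra. }
  rewrite pow1 in Hdist. apply Rabs_def2 in Hdist. lra.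
Qed.

(** * The Hankel determinant of a convex function *)

Lemma Cderivative_unique g z l1 l2 : Cderivative g z l1 -> Cderivative g z l2 -> l1 = l2.
Proof.
  intros H1 H2. rewrite <- (is_C_derive_unique _ _ _ H1). exact (is_C_derive_unique _ _ _ H2).
Qed.

Lemma expands_derivative a g g' : expands a g ->
  (forall z, (Cmod z < 1)%R -> Cderivative g z (g' z)) -> expands (deriv_coef a) g'.
Proof.
  intros H Hg. destruct (deriv_coef_expands _ _ H) as [g1 H1].
  intros z Hz. rewrite (Cderivative_unique _ _ _ _ (Hg z Hz) (power_series_derivative _ _ _ _ H H1 Hz)).
  exact (H1 z Hz).
Qed.

(** [g + z g'] is the derivative of [z g], whence the factor [n + 1]. *)
Lemma expands_plus_mult_derivative d g g' : expands d g -> expands (deriv_coef d) g' ->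
  expands (fun n => INR (S n) * d n) (fun z => g z + z * g' z).
Proof.
  intros H H' z Hz.
  refine (is_pseries_ext _ _ _ _ _ (is_pseries_plus _ _ _ _ _ (H z Hz)
    (is_pseries_incr_1 _ _ _ (H' z Hz)))).
  intros [|n].
  - change (d 0%nat + 0 = INR 1 * d 0%nat). simpl INR. ring.
  - change (d (S n) + INR (S n) * d (S n) = INR (S (S n)) * d (S n)).
    rewrite (S_INR (S n)), RtoC_plus. ring.
Qed.

(** Coefficients of [f' + z f''], the numerator of [1 + z f'' / f']. *)
Definition convex_numerator (a : nat -> C) (n : nat) : C := INR (S n) * deriv_coef a n.

(** Comparing coefficients in [p f' = f' + z f''] gives, for [n] from 2 to 5,
    [n (n - 1) a_n = sum_(k < n) k a_k c_(n - k)]; substituting these relations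
    turns both sides into the same polynomial in the [a_k]. *)
Lemma hankel_H31_caratheodory (a : nat -> C) : a 1%nat = 1 ->
  let c := quotient_coef (deriv_coef a) (convex_numerator a) in
  8640 * hankel_H31 a =
    - c 1%nat ^ 6 + 6 * c 1%nat ^ 4 * c 2%nat + 12 * c 1%nat ^ 3 * c 3%nat
    - 21 * c 1%nat ^ 2 * c 2%nat ^ 2 - 36 * c 1%nat ^ 2 * c 4%nat
    + 36 * c 1%nat * c 2%nat * c 3%nat - 4 * c 2%nat ^ 3 - 60 * c 3%nat ^ 2
    + 72 * c 2%nat * c 4%nat.
Proof.
  intros H1 c. unfold hankel_H31, det3. rewrite H1.
  assert (E1 : c 1%nat = 2 * a 2%nat).
  { unfold c, convex_numerator, deriv_coef; cbn [quotient_coef]. rewrite H1.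
    simpl INR. rewrite ?RtoC_plus. field. }
  assert (E2 : c 2%nat = 6 * a 3%nat - c 1%nat ^ 2).
  { rewrite E1. unfold c, convex_numerator, deriv_coef; cbn [quotient_coef]. rewrite H1.
    simpl INR. rewrite ?RtoC_plus. field. }
  assert (E3 : c 3%nat = 12 * a 4%nat - c 1%nat * c 2%nat - 3 * a 3%nat * c 1%nat).
  { rewrite E2, E1. unfold c, convex_numerator, deriv_coef; cbn [quotient_coef]. rewrite H1.
    simpl INR. rewrite ?RtoC_plus. field. }
  assert (E4 : c 4%nat = 20 * a 5%nat - c 1%nat * c 3%nat - 3 * a 3%nat * c 2%nat
      - 4 * a 4%nat * c 1%nat).
  { rewrite E3, E2, E1. unfold c, convex_numerator, deriv_coef; cbn [quotient_coef]. rewrite H1.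
    simpl INR. rewrite ?RtoC_plus. field. }
  rewrite E4, E3, E2, E1. ring.
Qed.

Lemma Cmod_plus_le (u v : C) (A B : R) :
  (Cmod u <= A)%R -> (Cmod v <= B)%R -> (Cmod (u + v) <= A + B)%R.
Proof. intros; eapply Rle_trans; [apply Cmod_triangle|]; lra. Qed.

Lemma Cmod_minus_le (u v : C) (A B : R) :
  (Cmod u <= A)%R -> (Cmod v <= B)%R -> (Cmod (u - v) <= A + B)%R.
Proof. intros; apply Cmod_plus_le; rewrite ?Cmod_opp; assumption. Qed.

Lemma Cmod_mult_le (u v : C) (A B : R) :
  (Cmod u <= A)%R -> (Cmod v <= B)%R -> (Cmod (u * v) <= A * B)%R.
Proof.
  intros; rewrite Cmod_mult; apply Rmult_le_compat; trivial; apply Cmod_ge_0.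
Qed.

Lemma Cmod_pow_le (u : C) (A : R) (n : nat) :
  (Cmod u <= A)%R -> (Cmod (u ^ n) <= A ^ n)%R.
Proof. intros; rewrite Cmod_pow; apply pow_incr; split; [apply Cmod_ge_0|assumption]. Qed.

Lemma Cmod_nonneg_real_le (x : R) : (0 <= x)%R -> (Cmod x <= x)%R.
Proof. intros; rewrite Cmod_R, Rabs_pos_eq; lra. Qed.

Theorem corollary3p6 :
  forall (f : C -> C) (a : nat -> C),
    class_convex f ->
    normalized_expansion f a ->
    (Cmod (hankel_H31 a) <= 15 / 24)%R.
Proof.
  intros f a [_ [f1 [f2 Hf]]] [_ [Ha1 Ha]].
  assert (X1 : expands (deriv_coef a) f1).
  { apply (expands_derivative a f); [exact Ha|]. intros z Hz; apply Hf, Hz. }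
  assert (X2 : expands (deriv_coef (deriv_coef a)) f2).
  { apply (expands_derivative _ f1); [exact X1|]. intros z Hz; apply Hf, Hz. }
  pose proof (expands_plus_mult_derivative _ _ _ X1 X2) as XN.
  assert (f1_neq_0 : forall z, (Cmod z < 1)%R -> f1 z <> 0) by (intros z Hz; apply Hf, Hz).
  set (c := quotient_coef (deriv_coef a) (convex_numerator a)).
  assert (Hc : forall n, (Cmod (c (S n)) <= 2)%R).
  { intros n.
    replace 2%R with (2 * Re (convex_numerator a 0%nat / deriv_coef a 0%nat))%R.
    - apply (caratheodory_bound _ _ _ _ n X1 f1_neq_0 XN).
      intros z Hz. destruct (Hf z Hz) as [_ [_ [H0 Hre]]]. left.
      replace ((f1 z + z * f2 z) / f1 z) with (1 + z * f2 z / f1 z) by (field; exact H0).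
      exact Hre.
    - replace (convex_numerator a 0%nat / deriv_coef a 0%nat) with (RtoC 1); [simpl; ring|].
      unfold convex_numerator, deriv_coef. rewrite Ha1. simpl INR. field. }
  pose proof (hankel_H31_caratheodory a Ha1) as E. cbv zeta in E. fold c in E.
  assert (HB : (Cmod (8640 * hankel_H31 a) <= 1920)%R).
  { rewrite E. eapply Rle_trans.
    - repeat first
        [ apply Hc | apply Cmod_nonneg_real_le; lra
        | rewrite Cmod_opp
        | apply Cmod_minus_le | apply Cmod_plus_le | apply Cmod_mult_le | apply Cmod_pow_le ].
    - simpl pow. lra. }
  rewrite Cmod_mult, Cmod_R, Rabs_pos_eq in HB by lra. lra.
Qed.
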